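(* Let $a,b\in R^{WD\dagger}$, let $a^{WD}$, $b^{WD}$ be WD inverses of $a$ and $b$, let $a^{WD\dagger}=a^{WD}aa^\dagger$, $b^{WD\dagger}=b^{WD}bb^\dagger$ be the associated WDMP inverses, and let $k=\max\{\mathrm{ind}(a),\mathrm{ind}(b)\}$. (1) If $ab$ has a WDMP inverse $(ab)^{WD\dagger}$ with $(ab)^{WD\dagger}=b^{WD\dagger}a^{WD\dagger}$, then: (i) $b(ab)^{WD\dagger}a=bb^\dagger a^{WD}a$; (ii) $b(ab)^{WD\dagger}a^{k+1}=bb^\dagger a^k$; (iii) $b^{k+1}(ab)^{WD\dagger}a=b^{k+1}b^\dagger a^{WD}a$. (2) If $ab$ has a WDMP inverse $(ab)^{WD\dagger}$ with $(ab)^{WD\dagger}=a^{WD\dagger}b^{WD\dagger}$, then: (i) $a(ab)^{WD\dagger}b=aa^\dagger b^{WD}b$; (ii) $a^{k+1}(ab)^{WD\dagger}b=a^{k+1}a^\dagger b^{WD}b$; (iii) $a(ab)^{WD\dagger}b^{k+1}=aa^\dagger b^k$.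
   Context: $R$ is a proper unital ring with involution: an associative ring with $1$ and a map $*:R\to R$ with $(a+b)^*=a^*+b^*$, $(ab)^*=b^*a^*$, $(a^* )^*=a$, such that $a^*a=0$ implies $a=0$. Moore-Penrose inverse: $a^\dagger$ is the unique $x$ (if it exists) with $axa=a$, $xax=x$, $(ax)^*=ax$, $(xa)^*=xa$; $R^\dagger$ is the set of Moore-Penrose invertible elements. Weak Drazin (WD) inverse: $a\in R$ is WD invertible if there are $x\in R$ and a positive integer $k$ with $axa=a$, $a^{k+1}x=a^k$, $xa^{k+1}=a^k$. The least positive integer $k$ for which such an $x$ exists is the weak Drazin index $\mathrm{ind}(a)$; any $x$ satisfying the three equations with $k=\mathrm{ind}(a)$ is a WD inverse of $a$ (not unique in general), denoted $a^{WD}$. $R^{WD}$ is the set of WD invertible elements. WDMP inverse: for $a\in R^{WD}\cap R^\dagger$, an element $y\in R$ is a WDMP inverse of $a$ if, for some WD inverse $a^{WD}$ of $a$ and $k=\mathrm{ind}(a)$, $yay=y$, $ay=aa^\dagger$, $ya^k=a^{WD}a^k$. $R^{WD\dagger}$ is the set of elements of $R^{WD}\cap R^\dagger$ having a WDMP inverse. For each WD inverse $a^{WD}$, the element $a^{WD}aa^\dagger$ is a WDMP inverse of $a$. *)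

(* Defs.v *)
From mathcomp Require Import all_boot all_algebra.

Set Implicit Arguments.
Unset Strict Implicit.
Unset Printing Implicit Defensive.

Import GRing.Theory.
Local Open Scope ring_scope.

Record proper_involution (R : pzRingType) (star : R -> R) : Prop :=
  ProperInvolution {
    starD : forall a b : R, star (a + b) = star a + star b;
    starM : forall a b : R, star (a * b) = star b * star a;
    starK : forall a : R, star (star a) = a;
    star_proper : forall a : R, star a * a = 0 -> a = 0
  }.

Record MP_inverse (R : pzRingType) (star : R -> R) (a x : R) : Prop :=
  MPInverse {
    MP_axa : a * x * a = a;
    MP_xax : x * a * x = x;
    MP_starax : star (a * x) = a * x;
    MP_starxa : star (x * a) = x * a
  }.

Definition MP_invertible (R : pzRingType) (star : R -> R) (a : R) : Prop :=
  exists x : R, MP_inverse star a x.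

Record WD_equations (R : pzRingType) (a : R) (k : nat) (x : R) : Prop :=
  WDEquations {
    WD_axa : a * x * a = a;
    WD_expr : a ^+ k.+1 * x = a ^+ k;
    WD_expl : x * a ^+ k.+1 = a ^+ k
  }.

Definition WD_invertible (R : pzRingType) (a : R) : Prop :=
  exists (x : R) (k : nat), (0 < k)%N /\ WD_equations a k x.

(* [WD_index a k] reads ind(a) = k; it holds for no [k] when [a] is not WD
   invertible. *)
Record WD_index (R : pzRingType) (a : R) (k : nat) : Prop :=
  WDIndex {
    WD_index_gt0 : (0 < k)%N;
    WD_index_ex : exists x : R, WD_equations a k x;
    WD_index_min : forall j : nat, (0 < j)%N ->
      (exists x : R, WD_equations a j x) -> (k <= j)%N
  }.

Definition WD_inverse (R : pzRingType) (a x : R) : Prop :=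
  exists k : nat, WD_index a k /\ WD_equations a k x.

Record WDMP_equations (R : pzRingType) (a ad aw : R) (k : nat) (y : R) : Prop :=
  WDMPEquations {
    WDMP_yay : y * a * y = y;
    WDMP_ay : a * y = a * ad;
    WDMP_yexp : y * a ^+ k = aw * a ^+ k
  }.

Definition WDMP_inverse (R : pzRingType) (star : R -> R) (a y : R) : Prop :=
  exists (ad aw : R) (k : nat),
    [/\ MP_inverse star a ad, WD_inverse a aw, WD_index a k
      & WDMP_equations a ad aw k y].

Definition WDMP_invertible (R : pzRingType) (star : R -> R) (a : R) : Prop :=
  [/\ WD_invertible a, MP_invertible star a
    & exists y : R, WDMP_inverse star a y].

(* The Moore-Penrose inverse and the index are handled as relations; the next
   two lemmas show that each determines its value. *)
Lemma MP_inverse_uniq (R : pzRingType) (star : R -> R) (a x y : R) :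
  proper_involution star -> MP_inverse star a x -> MP_inverse star a y ->
  x = y.
Proof.
move=> [_ sM _ _] [axa xax sax sxa] [aya yay say sya].
have eq_l : a * x = a * y.
  by rewrite -sax -{1}aya -(mulrA (a * y)) sM sax say mulrA axa.
have eq_r : x * a = y * a.
  by rewrite -sxa -{1}aya -(mulrA a) mulrA sM sxa sya -mulrA (mulrA a) axa.
by rewrite -xax eq_r -mulrA eq_l mulrA.
Qed.

Lemma WD_index_uniq (R : pzRingType) (a : R) (j k : nat) :
  WD_index a j -> WD_index a k -> j = k.
Proof.
move=> [j0 jx jmin] [k0 kx kmin].
by apply/eqP; rewrite eqn_leq jmin // kmin.
Qed.

(* Main.v *)
Require Import Defs.
From mathcomp Require Import all_boot all_algebra.

Import GRing.Theory.
Local Open Scope ring_scope.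

(** In [b * (bWD * b * bd) * (aWD * a * ad) * a] the outer factors collapse by [b * bWD * b = b] and
    [a * ad * a = a], which gives identity (i). Multiplying it by [a ^+ k] on the right or [b ^+ k]
    on the left gives the power identities. The reversed product is the same computation with [a]
    and [b] exchanged. *)

(** The equation at the index, multiplied on the right by [a ^+ (k - ka)], persists for larger
    exponents; this is what allows the maximum of two indices. *)
Lemma WD_inverse_expl {R : pzRingType} {a aWD : R} {ka k : nat} :
  WD_inverse a aWD -> WD_index a ka -> (ka <= k)%N -> aWD * a ^+ k.+1 = a ^+ k.
Proof.
move=> [j [/WD_index_uniq idx [_ _ expl]]] /idx <- le_jk.
by rewrite -(subnKC le_jk) -addSn !exprD mulrA expl.
Qed.

Lemma WD_inverse_axa {R : pzRingType} {a aWD : R} :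
  WD_inverse a aWD -> a * aWD * a = a.
Proof. by case=> k [_ []]. Qed.

(** Keeping [k] free above [ka] lets one statement serve both orders of the product, with [k] the
    maximum. *)
Lemma WDMP_reverse_product {R : pzRingType} {star : R -> R}
    {a b ad : R} (bd : R) {aWD bWD : R} {ka k : nat} :
  MP_inverse star a ad -> WD_inverse a aWD -> WD_inverse b bWD ->
  WD_index a ka -> (ka <= k)%N ->
  let y := (bWD * b * bd) * (aWD * a * ad) in
  [/\ b * y * a = b * bd * aWD * a,
      b * y * a ^+ k.+1 = b * bd * a ^+ k
    & b ^+ k.+1 * y * a = b ^+ k.+1 * bd * aWD * a].
Proof.
move=> [aada _ _ _] wa /WD_inverse_axa bwb ia le_k y.
have bya : b * y * a = b * bd * aWD * a.
  by rewrite /y !mulrA bwb -!mulrA (mulrA a) aada.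
split=> //.
(* Peeling one [a] off the power exposes [b * y * a]; the [a] left by [bya] rebuilds [a ^+ k.+1],
   which [aWD] lowers to [a ^+ k]. *)
- by rewrite exprS mulrA bya -mulrA -exprS -mulrA (WD_inverse_expl wa ia le_k).
- by rewrite exprSr -2!(mulrA (b ^+ k)) bya !mulrA.
Qed.

Theorem theorem3p14 (R : pzRingType) (star : R -> R)
    (Rproper : proper_involution star)
    (a b ad bd aWD bWD : R) (ka kb : nat)
    (Ha : WDMP_invertible star a) (Hb : WDMP_invertible star b)
    (Had : MP_inverse star a ad) (Hbd : MP_inverse star b bd)
    (HaWD : WD_inverse a aWD) (HbWD : WD_inverse b bWD)
    (Hka : WD_index a ka) (Hkb : WD_index b kb) :
  let aWDMP := aWD * a * ad in
  let bWDMP := bWD * b * bd in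
  let k := maxn ka kb in
  (forall abWDMP : R, WDMP_inverse star (a * b) abWDMP ->
     abWDMP = bWDMP * aWDMP ->
     [/\ b * abWDMP * a = b * bd * aWD * a,
         b * abWDMP * a ^+ k.+1 = b * bd * a ^+ k
       & b ^+ k.+1 * abWDMP * a = b ^+ k.+1 * bd * aWD * a])
  /\
  (forall abWDMP : R, WDMP_inverse star (a * b) abWDMP ->
     abWDMP = aWDMP * bWDMP ->
     [/\ a * abWDMP * b = a * ad * bWD * b,
         a ^+ k.+1 * abWDMP * b = a ^+ k.+1 * ad * bWD * b
       & a * abWDMP * b ^+ k.+1 = a * ad * b ^+ k]).
Proof.
move=> aWDMP bWDMP k; split=> y _ ->.
- exact: (WDMP_reverse_product bd Had HaWD HbWD Hka (leq_maxl ka kb)).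
(* With the roles exchanged, the last two identities come out in the opposite order. *)
- by have [] := WDMP_reverse_product ad Hbd HbWD HaWD Hkb (leq_maxr ka kb).
Qed.
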